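(* Let $1\le k\le n$ be integers and let $a,b\in\mathbb{R}$ be distinct. Let $A\in\mathsf{S}^2(\mathbb{R}^n)$ have distinct eigenvalues and let $A=Q\operatorname{diag}(a_1,\dots,a_n)Q^{\mathsf T}$ be an eigenvalue decomposition with $Q\in\mathrm{O}_n(\mathbb{R})$. Then $X\in\operatorname{Gr}_{a,b}(k,n)$ is a stationary point of the Euclidean distance function $\delta_A$ if and only if \[ X=QP_\tau\begin{bmatrix}aI_k&0\\0&bI_{n-k}\end{bmatrix}P_\tau^{\mathsf T}Q^{\mathsf T} \] for some $\tau\in\mathfrak{S}_n$, where $P_\tau$ is the permutation matrix associated to $\tau$. Moreover, $\delta_A:\operatorname{Gr}_{a,b}(k,n)^{\mathbb{C}}\to\mathbb{C}$ has $\binom{n}{k}$ distinct stationary points and they are all contained in $\operatorname{Gr}_{a,b}(k,n)$.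
   Context: For $\mathbb{F}=\mathbb{R}$ or $\mathbb{C}$, $\mathsf{S}^2(\mathbb{F}^n)=\{X\in\mathbb{F}^{n\times n}: X^{\mathsf T}=X\}$ (transpose, not conjugate transpose); $\mathrm{O}_n(\mathbb{R})$ is the real orthogonal group; $\mathfrak{S}_n$ is the symmetric group. Quadratic model of the Grassmannian: $\operatorname{Gr}_{a,b}(k,n)=\{X\in \mathsf{S}^2(\mathbb{R}^n): (X-aI)(X-bI)=0,\ \operatorname{tr}(X)=ak+b(n-k)\}$. Its complex locus $\operatorname{Gr}_{a,b}(k,n)^{\mathbb{C}}$ is the set of $X\in \mathsf{S}^2(\mathbb{C}^n)$ satisfying the same equations. Both are smooth. The Euclidean distance function is $\delta_A(X)=\tfrac12\sum_{i,j}(x_{ij}-a_{ij})^2$ (no absolute values), with $a_{ij}$ here the entries of $A$. A point $X$ of $\mathcal{M}=\operatorname{Gr}_{a,b}(k,n)$ (resp. $\mathcal{M}=\operatorname{Gr}_{a,b}(k,n)^{\mathbb{C}}$) is a stationary point of $\delta_A$ on $\mathcal{M}$ if $\operatorname{tr}(Y^{\mathsf T}(X-A))=0$ for every $Y\in\mathbb{T}_X\mathcal{M}$. *)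

(* Defs.v *)
From HB Require Import structures.
From mathcomp Require Import all_boot all_order all_algebra all_fingroup.
From mathcomp Require Import all_classical all_reals all_analysis.
From mathcomp Require Import complex.

Set Implicit Arguments.
Unset Strict Implicit.
Unset Printing Implicit Defensive.

Import Order.TTheory GRing.Theory Num.Theory.
Import numFieldNormedType.Exports.

Local Open Scope ring_scope.
Local Open Scope classical_set_scope.

(* Instantiated at K = R this is Gr_{a,b}(k,n); at K = R[i] (with a, b embedded)
   it is the complex locus.  The transpose is never conjugated. *)
Definition quadric_Gr (K : numFieldType) (a b : K) (k n : nat) :
    set 'M[K]_n :=
  [set X | [/\ X^T = X,
               (X - a%:M) *m (X - b%:M) = 0 &
               \tr X = a * k%:R + b * (n - k)%:R]].

Arguments quadric_Gr {K} a b k n.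

(* Tangent vectors are velocities of smooth curves in M through X.  For
   K = R[i], derivability is complex derivability, so the curves are
   holomorphic near 0. *)
Definition tangent_space (K : numFieldType) (n : nat)
    (M : set 'M[K]_n) (X : 'M[K]_n) : set 'M[K]_n :=
  [set Y | exists gamma : K -> 'M[K]_n,
    [/\ gamma 0 = X,
        \forall t \near (0 : K), M (gamma t),
        \forall t \near (0 : K), forall m, derivable (gamma^`(m)) t 1 &
        gamma^`() 0 = Y]].

(* The squares carry no absolute value, also when K = R[i]. *)
Definition edist (K : numFieldType) (n : nat) (A X : 'M[K]_n) : K :=
  2^-1 * \sum_i \sum_j (X i j - A i j) ^+ 2.

(* \tr (Y^T *m (X - A)) is the derivative of edist A at X along Y; see
   is_derive_edist. *)
Definition stationary_point (K : numFieldType) (n : nat)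
    (M : set 'M[K]_n) (A : 'M[K]_n) : set 'M[K]_n :=
  [set X | M X /\
    forall Y, tangent_space M X Y -> \tr (Y^T *m (X - A)) = 0].

Lemma is_derive_edist (K : numFieldType) (n : nat) (A X Y : 'M[K]_n) :
  is_derive X Y (edist A) (\tr (Y^T *m (X - A))).
Proof.
have dcoord i j : is_derive X Y (fun Z : 'M[K]_n => Z i j : K) (Y i j).
  apply: DeriveDef; first exact/diff_derivable/differentiable_coord.
  rewrite /derive; apply: cvg_lim => //.
  apply: cvg_near_cst; near=> h; rewrite /= !mxE addrK [LHS]mulKf //.
  by near: h; exact: nbhs_dnbhs_neq.
pose f i j := (fun Z : 'M[K]_n => Z i j : K) - cst (A i j).
have -> : edist A = (2^-1 : K) \*: (\sum_i \sum_j f i j ^+ 2).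
  apply/funext => Z; rewrite /edist /= fct_sumE; congr (_ * _).
  apply: eq_bigr => i _; rewrite fct_sumE; apply: eq_bigr => j _.
  by rewrite exprfctE.
apply: is_derive_eq.
rewrite /mxtrace exchange_big /= [LHS]mulr_sumr; apply: eq_bigr => j _.
rewrite !mxE mulr_sumr; apply: eq_bigr => i _.
rewrite !mxE subr0 expr1 -[f i j X]/(X i j - A i j).
by rewrite -[X in 2^-1 * X = _]/(_ * _) mulrA mulKf ?pnatr_eq0 // mulrC.
Unshelve. all: by end_near. Qed.

Definition distinct_eigenvalues (F : fieldType) (n : nat) (A : 'M[F]_n) :=
  exists s : n.-tuple F, uniq s /\ all (eigenvalue A) s.

(* diag (a I_k, b I_{n-k}) *)
Definition two_block (K : numFieldType) (a b : K) (k n : nat) : 'M[K]_n :=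
  diag_mx (\row_(i < n) if (i < k)%N then a else b).

Arguments two_block {K} a b k n.

Definition complexify (R : realType) (n : nat) (A : 'M[R]_n) : 'M[R[i]]_n :=
  map_mx (real_complex R) A.

(* Main.v *)
Require Import Defs.
From HB Require Import structures.
From mathcomp Require Import all_boot all_order all_algebra all_fingroup.
From mathcomp Require Import all_classical all_reals all_analysis.
From mathcomp Require Import complex finmap ring.

Set Implicit Arguments.
Unset Strict Implicit.
Unset Printing Implicit Defensive.

Import Order.TTheory GRing.Theory Num.Theory.
Import numFieldNormedType.Exports.

Local Open Scope ring_scope.
Local Open Scope classical_set_scope.

(* Both fields are handled at once: a point X of the model is stationary for
   edist A iff it commutes with A.  For J = E_ij - E_ji, the Cayley
   transform of tJ rotates X along a rational curve with velocity
   2(JX - XJ), and tr ((JX - XJ)(X - A)) is a difference of the (i,j) and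
   (j,i) entries of the skew matrix AX - XA.  Conversely, differentiating
   X^2 = (a + b)X - ab along any curve shows that its velocity is
   trace-orthogonal to everything that commutes with X.  Since A has simple
   spectrum, the X commuting with it are diagonal in its eigenbasis, with
   entries a (k times) and b; they correspond to the k-subsets of 'I_n. *)

(** * Calculus of matrix-valued curves, in particular rational ones *)

Section MatrixCurves.
Variable K : numFieldType.

Lemma is_derive_scalel (W : normedModType K) (f : K -> K) (x v df : K)
    (w : W) :
  is_derive x v f df -> is_derive x v (fun t => f t *: w) (df *: w).
Proof.
move=> [fd <-]; set l := 'D_v f x.
have cvl : h^-1 *: ((fun t => f t *: w) (h *: v + x) - f x *: w)
    @[h --> (0 : K)^'] --> l *: w.
  apply: cvg_trans (cvgZr_tmp (a := w) fd); apply: near_eq_cvg; near=> h.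
  by rewrite /= -scalerBl scalerA.
apply: DeriveDef; first by apply/cvg_ex; exists (l *: w).
exact: cvg_lim cvl.
Unshelve. all: by end_near. Qed.

(** Expanding [G] in the basis [delta_mx i j] reduces this to scalar functions times constant
    vectors. *)
Lemma is_derive_mx (m n : nat) (G : K -> 'M[K]_(m, n)) (x v : K)
    (dG : 'M[K]_(m, n)) :
  (forall i j, is_derive x v (fun t => G t i j) (dG i j)) ->
  is_derive x v G dG.
Proof.
move=> dGij.
have -> : G = \sum_(i < m) \sum_(j < n) (fun t => G t i j *: delta_mx i j).
  apply/funext => t; rewrite fct_sumE {1}[G t]matrix_sum_delta.
  by apply: eq_bigr => i _; rewrite fct_sumE.
rewrite [dG]matrix_sum_delta.
apply: is_derive_sum => i; apply: is_derive_sum => j.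
exact: is_derive_scalel.
Qed.

Lemma is_derive_coord (m n : nat) (G : K -> 'M[K]_(m, n)) (x v : K)
    (dG : 'M[K]_(m, n)) i j :
  is_derive x v G dG -> is_derive x v (fun t => G t i j) (dG i j).
Proof.
move=> [Gd <-]; set l := 'D_v G x.
have cvl : h^-1 *: ((fun t => G t i j) (h *: v + x) - G x i j)
    @[h --> (0 : K)^'] --> l i j.
  have := cvg_comp _ _ Gd (@coord_continuous K m n i j l).
  apply: cvg_trans; apply: near_eq_cvg; near=> h.
  by rewrite /= !mxE.
apply: DeriveDef; first by apply/cvg_ex; exists (l i j).
exact: cvg_lim cvl.
Unshelve. all: by end_near. Qed.

Lemma is_derive_mulmx (m n p : nat) (F : K -> 'M[K]_(m, n))
    (G : K -> 'M[K]_(n, p)) (x v : K) dF dG :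
  is_derive x v F dF -> is_derive x v G dG ->
  is_derive x v (fun t => F t *m G t) (dF *m G x + F x *m dG).
Proof.
move=> hF hG; apply: is_derive_mx => i k.
have -> : (fun t => (F t *m G t) i k) =
    \sum_(j < n) ((fun t => F t i j) * (fun t => G t j k)).
  by apply/funext => t; rewrite fct_sumE mxE.
rewrite !mxE -big_split /=.
apply: is_derive_sum => j.
have -> : dF i j * G x j k + F x i j * dG j k =
    F x i j *: dG j k + G x j k *: dF i j.
  by rewrite addrC [dF i j * _]mulrC.
by apply: is_deriveM; apply: is_derive_coord.
Qed.

Lemma is_derive_trmx (m n : nat) (F : K -> 'M[K]_(m, n)) (x v : K) dF :
  is_derive x v F dF -> is_derive x v (fun t => (F t)^T) dF^T.
Proof.
move=> hF; apply: is_derive_mx => i j; rewrite mxE.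
have -> : (fun t => (F t)^T i j) = (fun t => F t j i).
  by apply/funext => t; rewrite mxE.
exact: is_derive_coord.
Qed.

(* The library's is_derive_poly needs a real field, which excludes R[i]. *)
Lemma is_derive_horner (p : {poly K}) (t : K) :
  is_derive t 1 (horner p) p^`().[t].
Proof.
elim/poly_ind: p => [|p c IH].
  have -> : horner (0 : {poly K}) = cst 0.
    by apply/funext => s; rewrite horner0.
  by rewrite deriv0 horner0; exact: is_derive_cst.
have -> : horner (p * 'X + c%:P) = horner p * id + cst c.
  by apply/funext => s; rewrite !hornerE fctE.
apply: is_derive_eq.
by rewrite derivD derivM derivX derivC !hornerE /GRing.scale /=; ring.
Qed.

Lemma quotient_rule_identity (x dx y dy : K) (k : nat) : y != 0 ->
  x * (- (y ^+ k) ^- 2 * (dy * y ^+ k.-1 *+ k)) + y ^- k * dx =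
  (dx * y - x * dy *+ k) / y ^+ k.+1.
Proof.
(* The case [k = 0] is separate because [k.-1] truncates there. *)
move=> y0; case: k => [|k]; first by rewrite !mulr0n !expr0 expr1; field.
have := expf_neq0 k y0; rewrite -[k.+1.-1]/k !exprS.
rewrite -[(_ * y ^+ k) *+ _]mulr_natr -[(x * _) *+ _]mulr_natr.
move: (y ^+ k) k.+1%:R => z m z0.
by field; rewrite y0 z0.
Qed.

Lemma is_derive_rat (p q : {poly K}) (k : nat) (t : K) : q.[t] != 0 ->
  is_derive t 1 (fun s => p.[s] / q.[s] ^+ k)
    ((p^`() * q - p * q^`() *+ k).[t] / q.[t] ^+ k.+1).
Proof.
move=> q0.
have dqk : is_derive t 1 (horner (q ^+ k)) (q ^+ k)^`().[t].
  exact: is_derive_horner.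
have qk0 : horner (q ^+ k) t != 0 by rewrite horner_exp expf_neq0.
have dV : is_derive t 1 (fun s => (horner (q ^+ k) s)^-1)
    (- (horner (q ^+ k) t) ^- 2 *: (q ^+ k)^`().[t]).
  by case: dqk => ex <-; apply: DeriveDef;
    [exact: derivableV | exact: deriveV].
have -> : (fun s => p.[s] / q.[s] ^+ k) =
    horner p * (fun s => (horner (q ^+ k) s)^-1).
  by apply/funext => s; rewrite [RHS]/= -[RHS]/(_ * _) horner_exp.
apply: (is_derive_eq (is_deriveM (is_derive_horner p t) dV)).
rewrite /= deriv_exp !hornerE !hornerMn !hornerM horner_exp.
exact: quotient_rule_identity.
Qed.

(** All entries share a denominator that is a power of one [q]: the quotient rule keeps this shape
    and raises the exponent by one, so derivatives of every order are covered by induction. *)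
Definition rat_mx (n : nat) (q : {poly K}) (P : 'M[{poly K}]_n) (k : nat)
    (t : K) : 'M[K]_n :=
  \matrix_(i, j) ((P i j).[t] / q.[t] ^+ k).

Lemma map_horner_polyC (n : nat) (t : K) (M : 'M[K]_n) :
  map_mx (horner_eval t) (map_mx polyC M) = M.
Proof. by apply/matrixP => i j; rewrite !mxE /horner_eval hornerC. Qed.

Lemma rat_mxE (n : nat) (q : {poly K}) (P : 'M[{poly K}]_n) m t :
  rat_mx q P m t = (q.[t] ^- m) *: map_mx (horner_eval t) P.
Proof. by apply/matrixP => i j; rewrite !mxE mulrC. Qed.

Lemma is_derive_rat_mx (n : nat) (q : {poly K}) (P : 'M[{poly K}]_n) k t :
  q.[t] != 0 -> is_derive t 1 (rat_mx q P k)
    (rat_mx q (\matrix_(i, j) ((P i j)^`() * q - P i j * q^`() *+ k)) k.+1 t).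
Proof.
move=> q0; apply: is_derive_mx => i j; rewrite !mxE.
have -> : (fun s => rat_mx q P k s i j) = fun s => (P i j).[s] / q.[s] ^+ k.
  by apply/funext => s; rewrite mxE.
exact: is_derive_rat.
Qed.

Lemma near_horner_neq0 (q : {poly K}) (t : K) : q.[t] != 0 ->
  \forall s \near t, q.[s] != 0.
Proof.
have [/derivable1_diffP/differentiable_continuous cq _] := is_derive_horner q t.
by move=> q0; exact: cvgr_neq0 cq q0.
Qed.

Lemma derive1n_rat_mx (n : nat) (q : {poly K}) (P : 'M[{poly K}]_n) k m :
  exists P' k', forall t, q.[t] != 0 ->
    ((rat_mx q P k)^`(m)) t = rat_mx q P' k' t.
Proof.
elim: m => [|m [P' [k' IH]]]; first by exists P, k.
exists (\matrix_(i, j) ((P' i j)^`() * q - P' i j * q^`() *+ k')), k'.+1.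
move=> t q0; rewrite /= derive1E.
(* The induction hypothesis holds only where [q] does not vanish, which is a neighbourhood of [t];
   that suffices for the derivative at [t]. *)
rewrite (near_eq_derive (g := rat_mx q P' k')); last first.
  by near=> s; apply: IH; near: s; exact: near_horner_neq0.
by have [_ ->] := is_derive_rat_mx P' k' q0.
Unshelve. all: by end_near. Qed.

Lemma derivable_rat_mx (n : nat) (q : {poly K}) (P : 'M[{poly K}]_n) k m t :
  q.[t] != 0 -> derivable ((rat_mx q P k)^`(m)) t 1.
Proof.
move=> q0; have [P' [k' E]] := derive1n_rat_mx q P k m.
apply: (@near_eq_derivable _ _ _ (rat_mx q P' k')).
  by near=> s; apply/esym/E; near: s; exact: near_horner_neq0.
by have [] := is_derive_rat_mx P' k' q0.
Unshelve. all: by end_near. Qed.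

End MatrixCurves.

(** * Stationarity is equivalent to commuting with [A] *)

Section StationaryPoints.
Variables (K : numFieldType) (n : nat).
Implicit Types (A X Y M g J : 'M[K]_n) (a b : K).

Lemma quadric_Gr_sqr a b k X :
  quadric_Gr a b k n X -> X *m X = (a + b) *: X - (a * b)%:M.
Proof.
case=> _ /eqP; rewrite mulmxBl !mulmxBr !mul_scalar_mx mul_mx_scalar.
rewrite scale_scalar_mx -addrA -opprD subr_eq0 => /eqP -> _.
by rewrite scalerDl addrA [b *: X + _]addrC.
Qed.

Lemma quadric_Gr_conj a b k g X : g^T *m g = 1%:M ->
  quadric_Gr a b k n X -> quadric_Gr a b k n (g *m X *m g^T).
Proof.
move=> gg [Xs XX trX].
have gg' : g *m g^T = 1%:M by exact: mulmx1C.
have sub c : g *m X *m g^T - c%:M = g *m (X - c%:M) *m g^T.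
  by rewrite mulmxBr mulmxBl mul_mx_scalar -scalemxAl gg' scalemx1.
split.
- by rewrite !trmx_mul trmxK Xs mulmxA.
- rewrite !sub -!mulmxA [g^T *m (g *m _)]mulmxA gg mul1mx.
  by rewrite [(_ - a%:M) *m (_ *m _)]mulmxA XX mul0mx mulmx0.
- by rewrite mxtrace_mulC mulmxA gg mul1mx.
Qed.

Lemma near0_1DX2_neq0 : \forall t \near (0 : K), (1 + 'X^2 : {poly K}).[t] != 0.
Proof.
by apply: near_horner_neq0; rewrite !hornerE expr0n addr0 oner_eq0.
Qed.

(* The Cayley transform (1 + tJ)(1 - tJ)^-1, which is rational in t because
   J^3 = -J. *)
Definition cayley_rotation J : K -> 'M[K]_n :=
  rat_mx (1 + 'X^2) ((1 + 'X^2)%:M + (2%:R * 'X) *: map_mx polyC J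
    + (2%:R * 'X^2) *: map_mx polyC (J *m J)) 1.

(** With t = tan(u/2) this is Rodrigues' formula 1 + sin(u) J + (1 - cos(u)) J^2. *)
Lemma cayley_rotationE J t : (1 + 'X^2 : {poly K}).[t] != 0 ->
  cayley_rotation J t = 1%:M + (2%:R * t / (1 + t ^+ 2)) *: J
    + (2%:R * t ^+ 2 / (1 + t ^+ 2)) *: (J *m J).
Proof.
rewrite !hornerE => t0; apply/matrixP => i j; rewrite !mxE expr1.
rewrite !hornerE hornerMn !hornerE.
by case: (i == j); rewrite ?mulr1n ?mulr0n; field.
Qed.

Lemma cayley_rotation0 J : cayley_rotation J 0 = 1%:M.
Proof.
rewrite cayley_rotationE ?expr0n ?mulr0 ?mul0r ?scale0r ?addr0 //.
by rewrite !hornerE expr0n addr0 oner_eq0.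
Qed.

Lemma is_derive_cayley_rotation J :
  is_derive (0 : K) (1 : K) (cayley_rotation J) (2%:R *: J).
Proof.
have q0 : (1 + 'X^2 : {poly K}).[0] != 0.
  by rewrite !hornerE expr0n addr0 oner_eq0.
apply: (is_derive_eq (is_derive_rat_mx _ _ q0)); apply/matrixP => i j.
rewrite !mxE; move: (\sum_j0 _) => c; rewrite !expr2.
rewrite !(derivD, derivM, derivMn, derivX, derivC, hornerE) /=.
by case: (i == j); rewrite ?mulr0n ?mulr1n !hornerE /=; field.
Qed.

Lemma cayley_rotation_orth J t : J^T = - J -> J *m J *m J = - J ->
  (1 + 'X^2 : {poly K}).[t] != 0 ->
  (cayley_rotation J t)^T *m cayley_rotation J t = 1%:M.
Proof.
move=> Jskew J3 t0; rewrite cayley_rotationE //; rewrite !hornerE in t0.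
set al := _ / _; set be := _ / _.
(* In the role of sin(u) and 1 - cos(u), [al] and [be] satisfy the Pythagorean identity in this
   form; it kills the coefficient of J^2 below. *)
have alE : al ^+ 2 + be ^+ 2 = 2%:R * be by rewrite /al /be; field.
rewrite !linearD /= !linearZ /= trmx_mul Jskew mulmxN mulNmx opprK trmx1.
have J4 : J *m J *m (J *m J) = - (J *m J) by rewrite mulmxA J3 mulNmx.
have J3' : J *m (J *m J) = - J by rewrite mulmxA.
rewrite !(mulmxDl, mulmxDr) !mul1mx !mulmx1.
rewrite -!scalemxAl mulNmx J3 mulNmx J4 J3'.
apply/matrixP => i j; rewrite 2!mxE; move: (J *m J) => J2; rewrite !mxE.
transitivity ((i == j)%:R + (2%:R * be - (al ^+ 2 + be ^+ 2)) * J2 i j).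
  by ring.
by rewrite alE subrr mul0r addr0.
Qed.

(** Traces against these matrices recover every off-diagonal entry of a skew [M]. *)
Lemma trace_delta_skew M i j :
  \tr ((delta_mx i j - delta_mx j i) *m M) = M j i - M i j.
Proof.
have tr p q : \tr (delta_mx p q *m M) = M q p.
  rewrite /mxtrace (bigD1 p) //= big1 ?addr0 => [|r rp].
    rewrite mxE (bigD1 q) //= big1 ?addr0 => [|s sq].
      by rewrite mxE !eqxx mul1r.
    by rewrite mxE (negPf sq) andbF mul0r.
  by rewrite mxE big1 // => s _; rewrite mxE (negPf rp) mul0r.
by rewrite mulmxBl linearB /= !tr.
Qed.

(** -J^2 is the projection onto the plane of the i-th and j-th basis vectors, on which J acts. *)
Lemma delta_skew_cube (i j : 'I_n) : i != j ->
  let J := delta_mx i j - delta_mx j i : 'M[K]_n in J *m J *m J = - J.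
Proof.
move=> ij J; have ji : j != i by rewrite eq_sym.
have JJ : J *m J = - (delta_mx i i + delta_mx j j).
  rewrite /J mulmxBl !mulmxBr !mul_delta_mx_cond !eqxx (negPf ij) (negPf ji).
  by rewrite !mulr0n !mulr1n sub0r subr0 opprD.
rewrite JJ mulNmx; congr (- _).
rewrite /J mulmxBr !mulmxDl !mul_delta_mx_cond !eqxx (negPf ij) (negPf ji).
by rewrite !mulr0n !mulr1n addr0 add0r.
Qed.

(** Conjugating [X] by the Cayley curve stays in the model; the product rule at 0 gives 2JX +
    X(2J)^T. *)
Lemma tangent_commutator a b k X J : J^T = - J -> J *m J *m J = - J ->
  quadric_Gr a b k n X ->
  tangent_space (quadric_Gr a b k n) X (2%:R *: (J *m X - X *m J)).
Proof.
move=> Jskew J3 grX.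
pose g := cayley_rotation J.
pose G : 'M[{poly K}]_n := (1 + 'X^2)%:M + (2%:R * 'X) *: map_mx polyC J
    + (2%:R * 'X^2) *: map_mx polyC (J *m J).
exists (fun t => g t *m X *m (g t)^T).
(* Each of the two rotation factors contributes one power of the denominator. *)
have smooth : (fun t => g t *m X *m (g t)^T) =
    rat_mx (1 + 'X^2) (G *m map_mx polyC X *m G^T) 2.
  apply/funext => t; rewrite /g /cayley_rotation -/G !rat_mxE.
  rewrite !map_mxM -map_trmx map_horner_polyC !linearZ /=.
  rewrite -!scalemxAl !scalerA -exprVn; congr (_ *: _).
  by rewrite !exprVn expr1 -invfM -expr2.
have dg := is_derive_cayley_rotation J.
split.
- by rewrite /g cayley_rotation0 mul1mx trmx1 mulmx1.
- near=> t; apply: quadric_Gr_conj => //; apply: cayley_rotation_orth => //.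
  by near: t; exact: near0_1DX2_neq0.
- near=> t => m; rewrite smooth; apply: derivable_rat_mx.
  by near: t; exact: near0_1DX2_neq0.
- have dgX := is_derive_mulmx dg (is_derive_cst X (0 : K) (1 : K)).
  have [_] := is_derive_mulmx dgX (is_derive_trmx dg).
  rewrite derive1E => ->; rewrite /g cayley_rotation0 trmx1 !mulmx1 !mul1mx.
  by rewrite addr0 linearZ /= Jskew -scalemxAl -scalemxAr mulmxN -scalerDr.
Unshelve. all: by end_near. Qed.

(** By cyclicity of the trace the terms quadratic in [X] cancel. *)
Lemma mxtrace_commutator J X A :
  \tr ((J *m X - X *m J) *m (X - A)) = \tr (J *m (A *m X - X *m A)).
Proof.
rewrite mulmxBl !mulmxBr !linearB /= -!(mulmxA X).
rewrite [\tr (X *m _)]mxtrace_mulC [\tr (X *m (J *m A))]mxtrace_mulC.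
rewrite -!mulmxA; set u := \tr _; set v := \tr _; set w := \tr _.
by ring.
Qed.

Lemma stationary_comm a b k A X : A^T = A ->
  stationary_point (quadric_Gr a b k n) A X -> X *m A = A *m X.
Proof.
move=> As [grX sX]; have [Xs _ _] := grX.
have AXs : (A *m X - X *m A)^T = - (A *m X - X *m A).
  by rewrite linearB /= !trmx_mul As Xs opprB.
apply/matrixP => i j; apply/eqP; rewrite eq_sym -subr_eq0; apply/eqP.
have [<-|ij] := eqVneq i j.
  (* A diagonal entry of a skew matrix equals its own negative. *)
  have := congr1 (fun Z : 'M[K]_n => Z i i) AXs; rewrite !mxE => /eqP.
  by rewrite -addr_eq0 -mulr2n mulrn_eq0 => /eqP.
pose J : 'M[K]_n := delta_mx i j - delta_mx j i.
have Jskew : J^T = - J by rewrite linearB /= !trmx_delta opprB.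
have := sX _ (tangent_commutator Jskew (delta_skew_cube ij) grX).
set Y := J *m X - X *m J.
have -> : (2%:R *: Y)^T = 2%:R *: Y.
  by rewrite linearZ /= linearB /= !trmx_mul Jskew Xs mulmxN mulNmx opprK addrC.
have -> : \tr ((2%:R *: Y) *m (X - A)) = 2%:R * \tr (J *m (A *m X - X *m A)).
  rewrite -scalemxAl linearZ /=; congr (_ * _).
  exact: mxtrace_commutator.
rewrite trace_delta_skew => /eqP; rewrite mulf_eq0 pnatr_eq0 /=.
have := congr1 (fun Z : 'M[K]_n => Z i j) AXs; rewrite !mxE => ->.
by rewrite -opprD oppr_eq0 -mulr2n mulrn_eq0 => /eqP.
Qed.

(* Differentiating the quadratic relation gives YX + XY = (a + b)Y, which for
   every M commuting with X forces (a - b)^2 tr (YM) = 0. *)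
Lemma comm_trace_tangent a b X Y M : a != b ->
  X *m X = (a + b) *: X - (a * b)%:M ->
  Y *m X + X *m Y = (a + b) *: Y -> X *m M = M *m X -> \tr (Y *m M) = 0.
Proof.
move=> ab X2 YX XM.
(* Multiply the relation for [Y] by [N] and take traces: cyclicity merges the two terms on the
   left. *)
have tr2 N : X *m N = N *m X ->
    2%:R * \tr (Y *m (X *m N)) = (a + b) * \tr (Y *m N).
  move=> XN; have := congr1 (fun Z => \tr (Z *m N)) YX.
  rewrite mulmxDl linearD /= -scalemxAl linearZ /= => <-.
  rewrite -!mulmxA [\tr (X *m _)]mxtrace_mulC -[Y *m N *m X]mulmxA -XN.
  by rewrite mulr_natl mulr2n.
have e1 := tr2 _ XM; have := tr2 (X *m M).
rewrite {1}XM mulmxA => /(_ erefl); rewrite [X *m (X *m M)]mulmxA X2.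
rewrite mulmxBl mulmxBr linearB /= -scalemxAl mul_scalar_mx -!scalemxAr.
rewrite !linearZ /= => e2.
have : (a - b) ^+ 2 * \tr (Y *m M) = 0.
  move: e1 e2; move: (\tr _) (\tr _) => u v e1 e2.
  (* This combination of the cases N = M and N = XM eliminates v = tr(YXM), and (a + b)^2 - 4ab = (a
     - b)^2. *)
  transitivity ((a + b) * ((a + b) * u - 2%:R * v)
    + 2%:R * (2%:R * ((a + b) * v + (a * b) * - u) - (a + b) * v)).
    by ring.
  by rewrite -[_ * - u]/(_ *: - u) e1 e2 !subrr !mulr0 addr0.
by move=> /eqP; rewrite mulf_eq0 sqrf_eq0 subr_eq0 (negPf ab) /= => /eqP.
Qed.

Lemma comm_stationary a b k A X : a != b -> quadric_Gr a b k n X ->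
  X *m A = A *m X -> stationary_point (quadric_Gr a b k n) A X.
Proof.
move=> ab grX XA; split=> // Y [gam [g0 grg smooth dY]].
have dg : is_derive (0 : K) (1 : K) gam Y.
  apply: DeriveDef; last by rewrite -derive1E.
  exact: (nbhs_singleton smooth 0%N).
have Ys : Y^T = Y.
  have [_ <-] := is_derive_trmx dg; have [_ <-] := dg.
  apply: near_eq_derive; near=> t.
  by have [] : quadric_Gr a b k n (gam t) by near: t.
(* Differentiate the quadratic relation, which [gam] satisfies near 0. *)
have YX : Y *m X + X *m Y = (a + b) *: Y.
  have [_] := is_derive_mulmx dg dg; rewrite g0 => <-.
  have [_ <-] := is_deriveZ (a + b) dg.
  transitivity ('D_1 (fun t => (a + b) *: gam t - (a * b)%:M) 0); last first.
    by rewrite deriveB ?derive_cst ?subr0 //; case: (is_deriveZ (a + b) dg).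
  apply: near_eq_derive; near=> t.
  by apply: quadric_Gr_sqr (_ : quadric_Gr a b k n (gam t)); near: t.
rewrite Ys; apply: (comm_trace_tangent ab (quadric_Gr_sqr grX) YX).
(* The matrix X - A commutes with X because A does. *)
by rewrite mulmxBl mulmxBr XA.
Unshelve. all: by end_near. Qed.

End StationaryPoints.

(** * The stationary points in an eigenbasis of [A] *)

Section Diagonalization.
Variables (K : numFieldType) (n : nat).
Implicit Types (A X Q : 'M[K]_n) (d : 'rV[K]_n) (a b : K) (S : {set 'I_n}).

(** Indexing by subsets avoids the repetitions of the permutation form, where different permutations
    can give the same matrix. *)
Definition indicator_mx a b S : 'M[K]_n :=
  diag_mx (\row_i if i \in S then a else b).

Lemma mxtrace_indicator_mx a b S :
  \tr (indicator_mx a b S) = a * #|S|%:R + b * (n - #|S|)%:R.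
Proof.
rewrite mxtrace_diag (bigID (mem S)) /=.
rewrite (eq_bigr (fun=> a)) => [|i iS]; last by rewrite mxE iS.
rewrite [X in _ + X](eq_bigr (fun=> b)) => [|i iS]; last first.
  by rewrite mxE (negPf iS).
rewrite !sumr_const !mulr_natr; congr (_ + _ *+ _).
apply: (@addnI #|S|); rewrite [LHS]cardC card_ord subnKC //.
by rewrite -[leqRHS]card_ord max_card.
Qed.

Lemma quadric_Gr_indicator_mx a b S :
  quadric_Gr a b #|S| n (indicator_mx a b S).
Proof.
split; [exact: tr_diag_mx | | exact: mxtrace_indicator_mx].
rewrite -!diag_const_mx /indicator_mx -!linearB /= mulmx_diag.
apply/matrixP => i j; rewrite !mxE.
by case: ifP; rewrite subrr ?mulr0 ?mul0r mul0rn.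
Qed.

(** The quadratic relation forces each diagonal entry to be a or b, and the trace then fixes the
    number of entries a. *)
Lemma diag_quadric_Gr a b k X : a != b -> (k <= n)%N -> is_diag_mx X ->
  quadric_Gr a b k n X ->
  exists2 S : {set 'I_n}, #|S| = k & X = indicator_mx a b S.
Proof.
move=> ab kn /diag_mxP[r ->] [_ XX trX].
pose S := [set i | r 0 i == a]%SET; have rS : diag_mx r = indicator_mx a b S.
  congr diag_mx; apply/rowP => i; rewrite mxE inE; case: eqP => // /eqP ra.
  have := congr1 (fun Z : 'M[K]_n => Z i i) XX.
  rewrite -!diag_const_mx -!linearB /= mulmx_diag !mxE eqxx mulr1n.
  move/eqP; rewrite mulf_eq0 !subr_eq0 => /orP[/eqP re|/eqP //].
  by rewrite re eqxx in ra.
exists S => //.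
have Sn : (#|S| <= n)%N by rewrite -[leqRHS]card_ord max_card.
(* Both [k] and [#|S|] are at most [n], so the truncated subtractions become subtractions in [K]. *)
move: trX; rewrite rS mxtrace_indicator_mx !natrB // => e.
have : (a - b) * (#|S|%:R - k%:R) = 0.
  transitivity ((a * #|S|%:R + b * (n%:R - #|S|%:R))
    - (a * k%:R + b * (n%:R - k%:R))); first by ring.
  by rewrite e subrr.
move/eqP; rewrite mulf_eq0 !subr_eq0 (negPf ab) /= eqr_nat => /eqP.
by [].
Qed.

(** The (i,j) entry of the relation says that (d_j - d_i) X_ij = 0. *)
Lemma comm_diag_mx d X : injective (d 0) ->
  X *m diag_mx d = diag_mx d *m X -> is_diag_mx X.
Proof.
move=> dinj Xd; apply/is_diag_mxP => i j ij.
have := congr1 (fun Z : 'M[K]_n => Z i j) Xd.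
rewrite mul_mx_diag mul_diag_mx !mxE mulrC => /eqP.
rewrite -subr_eq0 -mulrBl mulf_eq0 subr_eq0 => /orP[/eqP/dinj ji|/eqP //].
by rewrite ji eqxx in ij.
Qed.

Lemma stationaryE a b k Q d A X : a != b -> (k <= n)%N -> injective (d 0) ->
  Q *m Q^T = 1%:M -> A = Q *m diag_mx d *m Q^T ->
  stationary_point (quadric_Gr a b k n) A X <->
  exists2 S : {set 'I_n}, #|S| = k & X = Q *m indicator_mx a b S *m Q^T.
Proof.
move=> ab kn dinj QQ AE.
have QQ' : Q^T *m Q = 1%:M by exact: mulmx1C.
have As : A^T = A by rewrite AE !trmx_mul trmxK tr_diag_mx mulmxA.
split=> [sX|[S Sk ->]].
  have [grX _] := sX; have XA := stationary_comm As sX.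
  (* In the eigenbasis [A] becomes [diag_mx d], so [Z] commutes with it and is diagonal. *)
  pose Z := Q^T *m X *m Q.
  have XZ : X = Q *m Z *m Q^T.
    by rewrite /Z !mulmxA QQ mul1mx -mulmxA QQ mulmx1.
  have grZ : quadric_Gr a b k n Z.
    have := @quadric_Gr_conj _ _ a b k Q^T X; rewrite trmxK; exact.
  have Zd : Z *m diag_mx d = diag_mx d *m Z.
    have -> : diag_mx d = Q^T *m A *m Q.
      by rewrite AE !mulmxA QQ' mul1mx -mulmxA QQ' mulmx1.
    rewrite /Z -!mulmxA [Q *m (Q^T *m _)]mulmxA [Q *m (Q^T *m (X *m Q))]mulmxA.
    by rewrite QQ !mul1mx [X *m (A *m Q)]mulmxA XA !mulmxA.
  have [S Sk ZS] := diag_quadric_Gr ab kn (comm_diag_mx dinj Zd) grZ.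
  by exists S; rewrite // -ZS.
have grS := quadric_Gr_conj QQ' (quadric_Gr_indicator_mx a b S).
rewrite Sk in grS; apply: comm_stationary => //; rewrite AE.
rewrite -!mulmxA [Q^T *m (Q *m _)]mulmxA [Q^T *m (Q *m (diag_mx _ *m _))]mulmxA.
by rewrite QQ' !mul1mx ![_ *m (_ *m Q^T)]mulmxA diag_mxC.
Qed.

Lemma eigenvalue_conj_diag Q d c : Q *m Q^T = 1%:M ->
  eigenvalue (Q *m diag_mx d *m Q^T) c -> c \in codom (d 0).
Proof.
move=> QQ /eigenvalueP[v vA v0].
have QQ' : Q^T *m Q = 1%:M by exact: mulmx1C.
have w0 : v *m Q != 0.
  by apply: contraNneq v0 => w0; rewrite -(mulmx1 v) -QQ mulmxA w0 mul0mx.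
have wd : v *m Q *m diag_mx d = c *: (v *m Q).
  by rewrite scalemxAl -vA -!mulmxA QQ' mulmx1.
have /rV0Pn[i wi] := w0.
have := congr1 (fun z : 'rV[K]_n => z 0 i) wd; rewrite mul_mx_diag !mxE mulrC.
have := wi; rewrite mxE => wi' /(mulIf wi') <-.
exact: codom_f.
Qed.

(** The n distinct eigenvalues all occur among the n entries of [d], which leaves no room for a
    repetition. *)
Lemma distinct_eigenvalues_inj Q d : Q *m Q^T = 1%:M ->
  distinct_eigenvalues (Q *m diag_mx d *m Q^T) -> injective (d 0).
Proof.
move=> QQ [s [us /allP sA]]; apply/injectiveP; rewrite /injectiveb /dinjectiveb.
apply: leq_size_uniq us _ _; last by rewrite !size_tuple card_ord.
by move=> c /sA /(eigenvalue_conj_diag QQ).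
Qed.

Lemma perm_mx_conj_diag (tau : 'S_n) d :
  perm_mx tau *m diag_mx d *m (perm_mx tau)^T = diag_mx (\row_i d 0 (tau i)).
Proof.
rewrite tr_perm_mx -row_permE -col_permE.
apply/matrixP => i j; rewrite !mxE.
by rewrite (inj_eq perm_inj).
Qed.

Lemma perm_two_block a b k (tau : 'S_n) :
  perm_mx tau *m two_block a b k n *m (perm_mx tau)^T =
  indicator_mx a b [set i | (tau i < k)%N]%SET.
Proof.
by rewrite perm_mx_conj_diag; congr diag_mx; apply/rowP => i; rewrite !mxE inE.
Qed.

End Diagonalization.

(** * Permutations and k-subsets *)

Lemma card_perm_initial n k (tau : 'S_n) : (k <= n)%N ->
  #|[set i | (tau i < k)%N]%SET| = k.
Proof.
move=> kn; pose f (j : 'I_k) := (tau^-1)%g (widen_ord kn j).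
have finj : injective f.
  by move=> x y /perm_inj /(congr1 val) xy; apply: val_inj.
rewrite -[RHS](card_ord k) -(card_imset _ finj).
apply: eq_card => i; rewrite !inE; apply/idP/imsetP => [ik|[j _ ->]].
  exists (Ordinal ik) => //; apply: (@perm_inj _ tau).
  by rewrite permKV; apply: val_inj.
by rewrite /f permKV /=.
Qed.

(** Splitting by the value of [f] shows that the count depends on [f] only through [#|f|]. This
    serves to compare boolean sequences up to permutation. *)
Lemma card_bool_preimset (T : finType) (f g : pred T) (a : pred bool) :
  #|f| = #|g| -> #|[pred i | a (f i)]| = #|[pred i | a (g i)]|.
Proof.
have cardE (h : pred T) : #|[pred i | a (h i)]| =
    (a true * #|h| + a false * (#|T| - #|h|))%N.
  rewrite -(cardC h) addKn -(cardID h [pred i | a (h i)]); congr (_ + _)%N.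
    case at_: (a true); rewrite ?mul1n ?mul0n;
      [apply: eq_card | apply: eq_card0];
      by move=> i; rewrite !unfold_in /=; case: (h i); rewrite ?at_ ?andbF.
  case af: (a false); rewrite ?mul1n ?mul0n; [apply: eq_card | apply: eq_card0];
    by move=> i; rewrite !unfold_in /=; case: (h i); rewrite ?af ?andbF.
by rewrite !cardE => ->.
Qed.

(** The indicator sequences of [S] and of the first k indices contain equally many [true], so a
    permutation carries one to the other. *)
Lemma exists_perm_initial n k (S : {set 'I_n}) : #|S| = k ->
  exists tau : 'S_n, S = [set i | (tau i < k)%N]%SET.
Proof.
move=> Sk; have kn : (k <= n)%N by rewrite -Sk -[leqRHS]card_ord max_card.
have cnt (a : pred bool) (f : 'I_n -> bool) :
    count a [tuple f i | i < n] = #|[pred i | a (f i)]|.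
  rewrite /= count_map cardE -size_filter !enumT.
  by apply/congr1/eq_filter.
have : perm_eq [tuple i \in S | i < n] [tuple (i < k)%N | i < n].
  apply/seq.permP => a; rewrite !cnt; apply: card_bool_preimset.
  (* The initial segment is the case of the identity permutation. *)
  rewrite -[RHS](_ : #|[set i | ((1%g : 'S_n) i < k)%N]%SET| = _); last first.
    by apply: eq_card => i; rewrite !inE perm1.
  by rewrite card_perm_initial.
case/tuple_permP => tau /val_inj e; exists tau.
apply/setP => i; rewrite inE.
by have := congr1 (fun t => tnth t i) e; rewrite !tnth_mktuple.
Qed.

(** * Classification and count of the stationary points *)

Lemma stationary_permE (K : numFieldType) (n k : nat) (a b : K) (A Q : 'M[K]_n)
    (d : 'rV[K]_n) (X : 'M[K]_n) : a != b -> (k <= n)%N -> injective (d 0) ->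
  Q *m Q^T = 1%:M -> A = Q *m diag_mx d *m Q^T ->
  stationary_point (quadric_Gr a b k n) A X <->
  exists tau : 'S_n,
    X = Q *m perm_mx tau *m two_block a b k n *m (perm_mx tau)^T *m Q^T.
Proof.
move=> ab kn dinj QQ AE.
have assoc tau : Q *m perm_mx tau *m two_block a b k n *m (perm_mx tau)^T *m Q^T
    = Q *m indicator_mx a b [set i | (tau i < k)%N]%SET *m Q^T.
  by rewrite -perm_two_block !mulmxA.
split=> [/(stationaryE _ ab kn dinj QQ AE)[S Sk ->]|[tau ->]].
  by have [tau ->] := exists_perm_initial Sk; exists tau; rewrite assoc.
apply/(stationaryE _ ab kn dinj QQ AE); rewrite assoc.
by eexists; last reflexivity; exact: card_perm_initial.
Qed.

Lemma card_stationary (K : numFieldType) (n k : nat) (a b : K) (A Q : 'M[K]_n)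
    (d : 'rV[K]_n) : a != b -> (k <= n)%N -> injective (d 0) ->
  Q *m Q^T = 1%:M -> A = Q *m diag_mx d *m Q^T ->
  (stationary_point (quadric_Gr a b k n) A #= `I_('C(n, k)))%card.
Proof.
move=> ab kn dinj QQ AE.
have QQ' : Q^T *m Q = 1%:M by exact: mulmx1C.
pose F (S : {set 'I_n}) := Q *m indicator_mx a b S *m Q^T.
pose D := [set S : {set 'I_n} | #|S| == k]%SET.
have -> : stationary_point (quadric_Gr a b k n) A = F @` [set` D].
  apply/seteqP; split=> [X /(stationaryE _ ab kn dinj QQ AE)[S Sk ->]|X [S]].
    by exists S => //=; rewrite inE Sk eqxx.
  rewrite /= inE => /eqP Sk <-; apply/(stationaryE _ ab kn dinj QQ AE).
  by exists S.
(* Undoing the conjugation by [Q], the diagonal entries recover [S] because a and b differ. *)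
have Finj : injective F.
  move=> S T /(congr1 (fun Z => Q^T *m Z *m Q)).
  rewrite /F -!mulmxA QQ' !mulmx1 ![Q^T *m (Q *m _)]mulmxA QQ' !mul1mx => ST.
  apply/setP => i; have := congr1 (fun Z : 'M[K]_n => Z i i) ST.
  rewrite !mxE eqxx !mulr1n => /eqP.
  by case: (i \in S); case: (i \in T); rewrite ?(negPf ab) // eq_sym (negPf ab).
apply: card_eq_trans (inj_card_eq (in2W Finj)) _.
have -> : [set` D] = [set` [fset S | S in D]%fset].
  by apply/seteqP; split=> S /=; rewrite !inE.
by apply/card_eq_fsetP; rewrite card_finset card_draws card_ord.
Qed.

Lemma complexify_indicator_mx (R : realType) (n : nat) (a b : R)
    (S : {set 'I_n}) :
  complexify (indicator_mx a b S) =
  indicator_mx (real_complex R a) (real_complex R b) S.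
Proof.
rewrite /complexify map_diag_mx; congr diag_mx; apply/rowP => i; rewrite !mxE.
by case: ifP.
Qed.

Theorem corollary4p2 (R : realType) (k n : nat) (hk : (1 <= k)%N)
    (hkn : (k <= n)%N) (a b : R) (hab : a != b)
    (A Q : 'M[R]_n) (d : 'rV[R]_n)
    (hA : A^T = A) (hdist : distinct_eigenvalues A)
    (hQ : Q *m Q^T = 1%:M) (hAQ : A = Q *m diag_mx d *m Q^T) :
  (forall X : 'M[R]_n,
     stationary_point (quadric_Gr a b k n) A X <->
     exists tau : 'S_n,
       X = Q *m perm_mx tau *m two_block a b k n *m (perm_mx tau)^T *m Q^T) /\
  let GrC := quadric_Gr (real_complex R a) (real_complex R b) k n in
  (stationary_point GrC (complexify A) #= `I_('C(n, k)))%card /\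
  stationary_point GrC (complexify A) `<=`
    (@complexify R n) @` quadric_Gr a b k n.
Proof.
have dinj : injective (d 0).
  by apply: (distinct_eigenvalues_inj hQ); rewrite -hAQ.
split=> [X|GrC]; first exact: stationary_permE hab hkn dinj hQ hAQ.
have ab' : real_complex R a != real_complex R b.
  by rewrite (inj_eq (@complexI R)).
(* With the plain transpose [Q] stays orthogonal over [R[i]], so the classification over a general
   field applies there too. *)
have QQ : complexify Q *m (complexify Q)^T = 1%:M.
  by rewrite /complexify map_trmx -map_mxM hQ map_mx1.
pose dC : 'rV[R[i]]_n := map_mx (real_complex R) d.
have AE : complexify A = complexify Q *m diag_mx dC *m (complexify Q)^T.
  by rewrite hAQ /complexify !map_mxM map_trmx map_diag_mx.
have dCinj : injective (dC 0) by move=> i j; rewrite !mxE => /complexI /dinj.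
split; first exact: card_stationary ab' hkn dCinj QQ AE.
move=> X /(stationaryE _ ab' hkn dCinj QQ AE)[S Sk ->].
(* The real matrix with the same index set [S] is stationary over [R], hence lies in the real
   model. *)
exists (Q *m indicator_mx a b S *m Q^T).
  by have [] : stationary_point (quadric_Gr a b k n) A
    (Q *m indicator_mx a b S *m Q^T)
    by apply/(stationaryE _ hab hkn dinj hQ hAQ); exists S.
by rewrite -complexify_indicator_mx /complexify !map_mxM map_trmx.
Qed.
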